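(* Let $p\ge 5$ be a prime and let $X$ be a circulant graph with $p$ vertices. If the group $E\subset\mathbb Z_p^*$ associated to $X$ is $2$-maximal in the ring $\mathbb Z_p$, then $X$ has no quantum symmetry.
   Context: A graph here is finite, with unoriented edges between distinct vertices and no multiple edges; its adjacency matrix $d$ has $d_{ij}=1$ if $i,j$ are joined by an edge and $0$ otherwise. $X$ being circulant with $p$ vertices means its vertices are labeled by $\mathbb Z_p$ with $i\sim j\iff j-i\in S$ for some set $S\subset\mathbb Z_p$. The associated group is $E=\{a\in\mathbb Z_p^*: aS=S\}$. For a commutative ring $R$ with $2\in R^*$, a subgroup $G\subset R^*$ is even if $-1\in G$; an even subgroup $G$ is $2$-maximal if whenever $a-b=2(c-d)$ with $a,b,c,d\in G$, then $a=\pm b$. A magic unitary in a $C^*$-algebra $A$ is a matrix $u=(u_{ij})\in M_n(A)$ of projections such that in each row and each column the entries are pairwise orthogonal and sum to $1$. With $G$ the automorphism group of $X$, let $\mathcal A$ be the universal $C^*$-algebra generated by the entries of a $p\times p$ magic unitary $u$ with $du=ud$. The functions $v_{ij}=\chi\{g\in G:g(j)=i\}\in C(G)$ form a magic unitary commuting with $d$, giving a canonical surjection $\mathcal A\to C(G)$, $u_{ij}\mapsto v_{ij}$. $X$ has no quantum symmetry if this map is an isomorphism. *)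

(* Defs.v *)
From HB Require Import structures.
From mathcomp Require Import all_boot all_order all_algebra all_fingroup.
From mathcomp Require Import complex.
From mathcomp Require Import all_classical all_reals.
From mathcomp Require Import topology normedtype.

Set Implicit Arguments.
Unset Strict Implicit.
Unset Printing Implicit Defensive.

Import Order.TTheory GRing.Theory Num.Theory.
Import numFieldNormedType.Exports.
Import ComplexField.Normc.

Local Open Scope ring_scope.

(* Unital C*-algebras over R[i].  The library has no structure that is both a
   ring and a normed module (Hierarchy-Builder rejects the join after
   [numDomainType]), so the norm and its completeness are fields here.
   An [algType] is nontrivial, hence the zero algebra is left out; this does
   not affect the universal property below, since every algebra has exactly
   one unital *-morphism to the zero algebra. *)
HB.mixin Record isCStar (R : realType) A & GRing.Algebra R[i] A := {
  star : A -> A;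
  cnorm : A -> R;
  starK : involutive star;
  starD : {morph star : x y / x + y};
  starZ : forall (a : R[i]) (x : A), star (a *: x) = conjc a *: star x;
  starM : forall x y : A, star (x * y) = star y * star x;
  cnormD : forall x y : A, cnorm (x + y) <= cnorm x + cnorm y;
  cnormZ : forall (a : R[i]) (x : A), cnorm (a *: x) = normc a * cnorm x;
  cnorm0_eq0 : forall x : A, cnorm x = 0 -> x = 0;
  cnormM : forall x y : A, cnorm (x * y) <= cnorm x * cnorm y;
  cnorm_starM : forall x : A, cnorm (star x * x) = cnorm x ^+ 2;
  cnorm_complete : forall x : nat -> A,
    (forall e : R, 0 < e -> exists N : nat, forall m n : nat,
       (N <= m)%N -> (N <= n)%N -> cnorm (x m - x n) < e) ->
    exists l : A, forall e : R, 0 < e -> exists N : nat, forall n : nat,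
       (N <= n)%N -> cnorm (x n - l) < e
}.

#[short(type="cstarType")]
HB.structure Definition CStarAlgebra (R : realType) :=
  {A of GRing.Algebra R[i] A & isCStar R A}.

Definition starhom (R : realType) (A B : cstarType R) (phi : A -> B) : Prop :=
  [/\ forall (a : R[i]) (x y : A), phi (a *: x + y) = a *: phi x + phi y,
      phi 1 = 1,
      {morph phi : x y / x * y} &
      {morph phi : x / star x}].

(* C(G) for a finite group G: pointwise operations and supremum norm. *)
Definition funalg (R : realType) (gT : finGroupType) : Type :=
  {ffun gT -> R[i]}.

Section FunAlg.
Variables (R : realType) (gT : finGroupType).
Local Notation CG := (funalg R gT).

HB.instance Definition _ := GRing.Lmodule.copy CG {ffun gT -> R[i]}.
HB.instance Definition _ := GRing.PzRing.copy CG {ffun gT -> R[i]}.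

Lemma funalg_oner_neq0 : (1 : CG) != 0.
Proof. exact: (@ffun1_nonzero gT R[i] 1%g). Qed.

HB.instance Definition _ :=
  GRing.PzSemiRing_isNonZero.Build CG funalg_oner_neq0.

Lemma funalg_scalerAl (a : R[i]) (f h : CG) : a *: (f * h) = (a *: f) * h.
Proof. by apply/ffunP => g; rewrite !ffunE /GRing.scale /= mulrA. Qed.

HB.instance Definition _ :=
  GRing.LSemiModule_isLSemiAlgebra.Build R[i] CG funalg_scalerAl.

Lemma funalg_scalerAr (a : R[i]) (f h : CG) : a *: (f * h) = f * (a *: h).
Proof. by apply/ffunP => g; rewrite !ffunE /GRing.scale /= mulrCA. Qed.

HB.instance Definition _ :=
  GRing.LSemiAlgebra_isSemiAlgebra.Build R[i] CG funalg_scalerAr.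

Definition fun_star (f : CG) : CG := [ffun g => conjc (f g)].

Definition fun_norm (f : CG) : R := \big[Num.max/0]_(g : gT) normc (f g).

Lemma normc_ge0 (z : R[i]) : 0 <= normc z.
Proof. by case: z => a b; exact: sqrtr_ge0. Qed.

Lemma fun_norm_ub (f : CG) (g : gT) : normc (f g) <= fun_norm f.
Proof. exact: (@le_bigmax _ _ _ _ (fun g => normc (f g))). Qed.

Lemma fun_norm_le (f : CG) (c : R) :
  0 <= c -> (forall g, normc (f g) <= c) -> fun_norm f <= c.
Proof. by move=> c0 fc; apply: bigmax_le. Qed.

Lemma fun_norm_lt (f : CG) (c : R) :
  0 < c -> (forall g, normc (f g) < c) -> fun_norm f < c.
Proof. by move=> c0 fc; apply: bigmax_lt. Qed.

Lemma fun_norm_ge0 (f : CG) : 0 <= fun_norm f.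
Proof. exact: le_trans (normc_ge0 (f 1%g)) (fun_norm_ub f 1%g). Qed.

Lemma fun_starK : involutive fun_star.
Proof. by move=> f; apply/ffunP => g; rewrite !ffunE conjcK. Qed.

Lemma fun_starD : {morph fun_star : f h / f + h}.
Proof. by move=> f h; apply/ffunP => g; rewrite !ffunE rmorphD. Qed.

Lemma fun_starZ (a : R[i]) (f : CG) :
  fun_star (a *: f) = conjc a *: fun_star f.
Proof. by apply/ffunP => g; rewrite !ffunE /GRing.scale /= rmorphM. Qed.

Lemma fun_starM (f h : CG) : fun_star (f * h) = fun_star h * fun_star f.
Proof. by apply/ffunP => g; rewrite !ffunE rmorphM mulrC. Qed.

Lemma fun_normD (f h : CG) : fun_norm (f + h) <= fun_norm f + fun_norm h.
Proof.
apply: fun_norm_le => [|g]; first by rewrite addr_ge0 ?fun_norm_ge0.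
rewrite ffunE; apply: le_trans (le_normcD _ _) _.
by rewrite lerD ?fun_norm_ub.
Qed.

Lemma fun_normM (f h : CG) : fun_norm (f * h) <= fun_norm f * fun_norm h.
Proof.
apply: fun_norm_le => [|g]; first by rewrite mulr_ge0 ?fun_norm_ge0.
by rewrite ffunE normcM ler_pM ?normc_ge0 ?fun_norm_ub.
Qed.

Lemma fun_normZ (a : R[i]) (f : CG) :
  fun_norm (a *: f) = normc a * fun_norm f.
Proof.
apply/eqP; rewrite eq_le; apply/andP; split.
  apply: fun_norm_le => [|g]; first by rewrite mulr_ge0 ?normc_ge0 ?fun_norm_ge0.
  by rewrite ffunE normcM ler_wpM2l ?normc_ge0 ?fun_norm_ub.
have [->|a0] := eqVneq a 0; first by rewrite normc0 mul0r fun_norm_ge0.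
have na : 0 < normc a.
  by rewrite lt_neqAle normc_ge0 andbT eq_sym; apply: contra_neq a0 => /eq0_normc.
rewrite mulrC -ler_pdivlMr//; apply: fun_norm_le => [|g].
  by rewrite divr_ge0 ?normc_ge0 ?fun_norm_ge0.
rewrite ler_pdivlMr// mulrC -normcM.
by have := fun_norm_ub (a *: f) g; rewrite ffunE.
Qed.

Lemma fun_norm0_eq0 (f : CG) : fun_norm f = 0 -> f = 0.
Proof.
move=> f0; apply/ffunP => g; rewrite ffunE; apply: eq0_normc.
by apply/eqP; rewrite eq_le normc_ge0 andbT -f0 fun_norm_ub.
Qed.

Lemma normc_conjM (z : R[i]) : normc (conjc z * z) = normc z ^+ 2.
Proof. by case: z => a b; rewrite normcM expr2 /= sqrrN. Qed.

Lemma fun_norm_starM (f : CG) : fun_norm (fun_star f * f) = fun_norm f ^+ 2.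
Proof.
apply/eqP; rewrite eq_le; apply/andP; split.
  apply: fun_norm_le => [|g]; first exact: sqr_ge0.
  by rewrite !ffunE normc_conjM lerXn2r ?nnegrE ?normc_ge0 ?fun_norm_ge0 ?fun_norm_ub.
have h0 := fun_norm_ge0 (fun_star f * f).
rewrite -[leRHS]sqr_sqrtr// lerXn2r ?nnegrE ?sqrtr_ge0 ?fun_norm_ge0//.
apply: fun_norm_le => [|g]; first exact: sqrtr_ge0.
rewrite -[leLHS]ger0_norm ?normc_ge0// -sqrtr_sqr ler_wsqrtr// -normc_conjM.
by have := fun_norm_ub (fun_star f * f) g; rewrite !ffunE.
Qed.

Lemma real_cauchy_lim (x : nat -> R) :
  (forall e : R, 0 < e -> exists N : nat, forall m n : nat,
     (N <= m)%N -> (N <= n)%N -> `|x m - x n| < e) ->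
  exists l : R, forall e : R, 0 < e -> exists N : nat, forall n : nat,
     (N <= n)%N -> `|x n - l| < e.
Proof.
move=> xC.
have /cauchy_cvgP /cvg_ex[l xl] : cauchy (x @ \oo)%classic.
  apply/cauchy_exP => e /xC[N NP]; exists (x N); exists N => // n /= Nn.
  by rewrite -ball_normE /= NP.
exists l => e e0; have /cvgrPdistC_lt /(_ e e0)[N _ NP] := xl.
by exists N => n Nn; exact: NP.
Qed.

Lemma normc_leD (z : R[i]) : normc z <= `|complex.Re z| + `|complex.Im z|.
Proof.
case: z => a b /=.
have <- : Num.sqrt ((`|a| + `|b|) ^+ 2) = `|a| + `|b|.
  by rewrite sqrtr_sqr ger0_norm ?addr_ge0.
rewrite ler_wsqrtr// sqrrD -[a ^+ 2]real_normK ?num_real//.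
rewrite -[b ^+ 2]real_normK ?num_real//.
by rewrite lerD2r lerDl mulrn_wge0 ?mulr_ge0.
Qed.

Lemma normc_Re (z : R[i]) : `|complex.Re z| <= normc z.
Proof. by case: z => a b /=; rewrite -sqrtr_sqr ler_wsqrtr// lerDl sqr_ge0. Qed.

Lemma normc_Im (z : R[i]) : `|complex.Im z| <= normc z.
Proof. by case: z => a b /=; rewrite -sqrtr_sqr ler_wsqrtr// lerDr sqr_ge0. Qed.

Lemma fun_complete (x : nat -> CG) :
  (forall e : R, 0 < e -> exists N : nat, forall m n : nat,
     (N <= m)%N -> (N <= n)%N -> fun_norm (x m - x n) < e) ->
  exists l : CG, forall e : R, 0 < e -> exists N : nat, forall n : nat,
     (N <= n)%N -> fun_norm (x n - l) < e.
Proof.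
move=> xC.
have ReB (u v : R[i]) : complex.Re (u - v) = complex.Re u - complex.Re v by case: u v => [? ?] [? ?].
have ImB (u v : R[i]) : complex.Im (u - v) = complex.Im u - complex.Im v by case: u v => [? ?] [? ?].
have /choice[a aP] : forall g, exists l : R, forall e : R, 0 < e ->
    exists N : nat, forall n : nat, (N <= n)%N -> `|complex.Re (x n g) - l| < e.
  move=> g; apply: real_cauchy_lim => e /xC[N NP]; exists N => m n Nm Nn.
  apply: le_lt_trans (NP _ _ Nm Nn); rewrite -ReB.
  apply: le_trans (normc_Re _) _.
  by have := fun_norm_ub (x m - x n) g; rewrite !ffunE.
have /choice[b bP] : forall g, exists l : R, forall e : R, 0 < e ->
    exists N : nat, forall n : nat, (N <= n)%N -> `|complex.Im (x n g) - l| < e.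
  move=> g; apply: real_cauchy_lim => e /xC[N NP]; exists N => m n Nm Nn.
  apply: le_lt_trans (NP _ _ Nm Nn); rewrite -ImB.
  apply: le_trans (normc_Im _) _.
  by have := fun_norm_ub (x m - x n) g; rewrite !ffunE.
exists [ffun g => Complex (a g) (b g)] => e e0.
have e20 : 0 < e / 2 by rewrite divr_gt0.
have /choice[N NP] : forall g, exists N : nat, forall n, (N <= n)%N ->
    normc (x n g - Complex (a g) (b g)) < e.
  move=> g; have [Na NaP] := aP g _ e20; have [Nb NbP] := bP g _ e20.
  exists (maxn Na Nb) => n; rewrite geq_max => /andP[na nb].
  apply: le_lt_trans (normc_leD _) _; rewrite ReB ImB [ltRHS]splitr.
  by rewrite ltrD ?NaP ?NbP.
exists (\max_g N g)%N => n Nn; apply: fun_norm_lt => // g.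
by rewrite !ffunE NP// (leq_trans _ Nn)// (@leq_bigmax _ N).
Qed.

HB.instance Definition _ := isCStar.Build R CG fun_starK fun_starD fun_starZ
  fun_starM fun_normD fun_normZ fun_norm0_eq0 fun_normM fun_norm_starM
  fun_complete.

End FunAlg.


Section Graphs.
Variable n : nat.

Record sgraph := SGraph {
  edge : rel 'I_n;
  edge_sym : symmetric edge;
  edge_irr : irreflexive edge
}.

Definition adjmx (A : nzRingType) (X : sgraph) : 'M[A]_n :=
  \matrix_(i, j) (edge X i j)%:R.

Definition graph_aut (X : sgraph) : {set 'S_n} :=
  [set g : 'S_n | [forall i, forall j, edge X (g i) (g j) == edge X i j]].

Lemma graph_aut_group_set (X : sgraph) : group_set (graph_aut X).
Proof.
apply/group_setP; split=> [|g h].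
  by rewrite inE; apply/'forall_'forall_eqP => i j; rewrite !perm1.
rewrite !inE => /'forall_'forall_eqP gX /'forall_'forall_eqP hX.
by apply/'forall_'forall_eqP => i j; rewrite !permM hX gX.
Qed.

Canonical graph_aut_group (X : sgraph) := Group (graph_aut_group_set X).

Section MagicUnitaries.
Variables (R : realType) (A : cstarType R).

Definition projection (p : A) : Prop := p * p = p /\ star p = p.

Definition magic_unitary (u : 'M[A]_n) : Prop :=
  [/\ forall i j, projection (u i j),
      forall i j k, j != k -> u i j * u i k = 0,
      forall i j k, j != k -> u j i * u k i = 0,
      forall i, \sum_j u i j = 1 &
      forall j, \sum_i u i j = 1].

Definition graph_magic_unitary (X : sgraph) (u : 'M[A]_n) : Prop :=
  magic_unitary u /\ adjmx A X *m u = u *m adjmx A X.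

End MagicUnitaries.

(* (A, u) is the universal C*-algebra generated by the entries of a magic
   unitary commuting with the adjacency matrix of X.  Uniqueness of phi
   expresses that the entries of u generate A. *)
Definition universal_graph_algebra (R : realType) (X : sgraph)
    (A : cstarType R) (u : 'M[A]_n) : Prop :=
  graph_magic_unitary X u /\
  forall (B : cstarType R) (w : 'M[B]_n), graph_magic_unitary X w ->
    exists! phi : A -> B, starhom phi /\ forall i j, phi (u i j) = w i j.

Definition aut_magic_unitary (R : realType) (X : sgraph) :
    'M[funalg R [subg graph_aut X]]_n :=
  \matrix_(i, j) [ffun g : [subg graph_aut X] => (val g j == i)%:R].

Lemma aut_magic_unitaryP (R : realType) (X : sgraph) :
  graph_magic_unitary X (aut_magic_unitary R X).
Proof.
have sumE I (F : I -> funalg R [subg graph_aut X]) (r : seq I) g :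
    (\sum_(i <- r) F i) g = \sum_(i <- r) F i g.
  exact: (@sum_ffunE _ R[i]).
split; last first.
  apply/matrixP => i k; rewrite !mxE; apply/ffunP => g; rewrite !sumE.
  have gX a b : edge X (val g a) (val g b) = edge X a b.
    by have := valP g; rewrite inE => /'forall_'forall_eqP.
  have natE m : (m%:R : funalg R [subg graph_aut X]) g = m%:R.
    by elim: m => [|m IHm]; rewrite ?ffunE// !mulrS ffunE IHm ffunE.
  transitivity ((edge X i (val g k))%:R : R[i]).
    rewrite (bigD1 (val g k))//= big1 ?addr0 => [|j jk].
      by rewrite !mxE ffunE natE ffunE eqxx mulr1.
    by rewrite !mxE ffunE natE ffunE eq_sym (negPf jk) mulr0.
  rewrite (bigD1 ((val g)^-1%g i))//= big1 ?addr0 => [|j jk].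
    rewrite !mxE ffunE natE ffunE permKV eqxx mul1r.
    by rewrite -[in RHS]gX permKV.
  rewrite !mxE ffunE natE ffunE; case: eqP => [gj|_]; last by rewrite mul0r.
  by rewrite -gj permK eqxx in jk.
split.
- move=> i j; split; apply/ffunP => g; rewrite !mxE !ffunE.
    by case: eqP; rewrite ?mulr0 ?mulr1.
  by rewrite rmorph_nat.
- move=> i j k jk; apply/ffunP => g; rewrite !mxE !ffunE.
  case: eqP => [<-|_]; last by rewrite mul0r.
  by rewrite (inj_eq perm_inj) eq_sym (negPf jk) mulr0.
- move=> i j k jk; apply/ffunP => g; rewrite !mxE !ffunE.
  by case: eqP => [->|_]; rewrite ?mul0r// (negPf jk) mulr0.
- move=> i; apply/ffunP => g; rewrite sumE ffunE.
  rewrite (bigD1 ((val g)^-1%g i))//= big1 ?addr0 => [|j jk].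
    by rewrite mxE ffunE permKV eqxx.
  rewrite mxE ffunE; case: eqP => [gj|//].
  by rewrite -gj permK eqxx in jk.
- move=> j; apply/ffunP => g; rewrite sumE ffunE.
  rewrite (bigD1 (val g j))//= big1 ?addr0 => [|i ij].
    by rewrite mxE ffunE eqxx.
  by rewrite mxE ffunE eq_sym (negPf ij).
Qed.

(* The canonical map exists and is unique by universality; a bijective
   *-morphism of C*-algebras is an isomorphism.  The first conjunct keeps the
   statement from being vacuous. *)
Definition no_quantum_symmetry (R : realType) (X : sgraph) : Prop :=
  (exists (A : cstarType R) (u : 'M[A]_n), universal_graph_algebra X u) /\
  forall (A : cstarType R) (u : 'M[A]_n), universal_graph_algebra X u ->
    exists pi : A -> funalg R [subg graph_aut X],
      [/\ starhom pi,
          forall i j, pi (u i j) = aut_magic_unitary R X i j &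
          bijective pi].

End Graphs.

(* 'F_p is Z/p only for prime p; l labels the vertices by Z/p. *)
Definition circulant (p : nat) (X : sgraph p) (l : 'F_p -> 'I_p)
    (S : {set 'F_p}) : Prop :=
  bijective l /\ forall i j : 'F_p, edge X (l i) (l j) = (j - i \in S).

Definition circulant_group (p : nat) (S : {set 'F_p}) : {set 'F_p} :=
  [set a : 'F_p | (a \is a GRing.unit) && ([set a * s | s in S] == S)].

Definition even_subgroup (K : comUnitRingType) (G : {pred K}) : Prop :=
  [/\ {subset G <= GRing.unit}, divr_closed G & -1 \in G].

Definition two_maximal (K : comUnitRingType) (G : {pred K}) : Prop :=
  [/\ (2%:R : K) \is a GRing.unit, even_subgroup G &
      forall a b c d : K, a \in G -> b \in G -> c \in G -> d \in G ->
        a - b = 2%:R * (c - d) -> a = b \/ a = - b].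

(* Main.v *)
(* Let xi be the function j |-> w^j on Z/p, for w a nontrivial p-th root of
   unity, and let alpha be the action given by a magic unitary u commuting
   with the adjacency matrix.  The eigenspaces of that matrix are spanned by
   the powers xi^l, and since w, ..., w^(p-1) are linearly independent over the
   rationals, two powers with nonzero exponents k, l share an eigenvalue only
   if l/k lies in E.  Hence alpha(xi^k) is a combination of the xi^(k a),
   a in E, for k in {1, -1, 2, -2}.  Comparing coefficients in
   alpha(xi^(k + k')) = alpha(xi^k) alpha(xi^k') for k + k' in {2, -2, 1, -1},
   2-maximality leaves at most one or two products on each side; they force
   the coefficients of alpha(xi) to be pairwise orthogonal, hence to commute,
   and with them all entries of u.  When the entries of u commute, the products
   prod_j u_(g j, j), g in Aut X, are orthogonal projections with sum 1, so
   that C(Aut X) itself has the universal property. *)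
Require Import Defs.
From mathcomp Require Import all_boot all_order all_algebra all_fingroup.
From mathcomp Require Import complex ring boolp.
From mathcomp Require Import all_reals.

Set Implicit Arguments.
Unset Strict Implicit.
Unset Printing Implicit Defensive.

Import Order.TTheory GRing.Theory Num.Theory.

Local Open Scope ring_scope.

(** * Rational independence of the nontrivial powers of a root of unity *)

(* Eisenstein's criterion for the cyclotomic polynomial at X + 1. *)
Lemma irreducible_bin_poly p : prime p ->
  irreducible_poly (\poly_(i < p) ('C(p, i.+1)%:Z)).
Proof.
move=> pp; have p0 := prime_gt0 pp; have p1 := prime_gt1 pp.
have szq : size (\poly_(i < p) ('C(p, i.+1)%:Z)) = p.
  by apply: size_poly_eq; rewrite prednK// binn.
apply: (@eisenstein_crit p) => //.
- by rewrite szq neq_ltn p1 orbT.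
- rewrite lead_coefE szq coef_poly ltn_predL p0 prednK// binn.
  by rewrite dvdzE /= dvdn1 neq_ltn p1 orbT.
- rewrite coef_poly p0 bin1 dvdzE.
  by rewrite /= natrXE -{2}[p]expn1 dvdn_Pexp2l.
move=> i; rewrite szq coef_poly => ip.
have ip' : (i.+1 < p)%N by rewrite -[X in (_ < X)%N](prednK p0).
by rewrite (ltn_trans _ ip')// dvdzE /= prime_dvd_bin.
Qed.

Lemma bin_poly_mulX (p : nat) :
  (\poly_(i < p) ('C(p, i.+1)%:Z)) * 'X = ('X + 1) ^+ p - 1 :> {poly int}.
Proof.
rewrite exprDn_comm; last exact: commr1.
rewrite big_ord_recr /= subnn expr0 mul1r expr1n binn.
rewrite addrK poly_def mulr_suml (reindex_inj rev_ord_inj) /=.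
apply: eq_bigr => i _; rewrite expr1n mulr1 -scalerAl -exprSr.
by rewrite subnSK // bin_sub// 1?ltnW// -scaler_nat natz.
Qed.

(** The irreducible [q] vanishes at [w - 1], so it divides [g = f(X + 1)]. The sizes make the
    quotient constant, and [g(-1) = f(0) = 0] with [q(-1) = 1] makes it zero. *)
Lemma root_unity_lin_indep (C : numFieldType) p (w : C) (f : {poly rat}) :
  prime p -> w ^+ p = 1 -> w != 1 -> (size f <= p)%N -> f`_0 = 0 ->
  root (map_poly ratr f) w -> f = 0.
Proof.
move=> pp wp w1 szf f0 fw.
pose q := map_poly intr (\poly_(i < p) ('C(p, i.+1)%:Z)) : {poly rat}.
have qX : q * 'X = ('X + 1) ^+ p - 1.
  rewrite -[X in q * X](map_polyX intr) -rmorphM bin_poly_mulX.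
  by rewrite rmorphB rmorphXn rmorphD /= map_polyX rmorph1.
have irq : irreducible_poly q.
  exact/irreducible_rat_int/irreducible_bin_poly.
have size_Xp1n : size (('X + 1%:P) ^+ p : {poly rat}) = p.+1.
  by rewrite -[1]opprK polyCN size_exp_XsubC.
have szq : size q = p.
  apply: succn_inj; rewrite -(size_mulX (p := q)); last first.
    by apply: contraTneq irq.1 => ->; rewrite size_poly0.
  rewrite qX -[X in (_ + X) ^+ _]polyC1.
  rewrite size_polyDl ?size_polyN ?size_poly1 ?size_Xp1n//.
  by rewrite ltnS prime_gt0.
pose g := f \Po ('X + 1%:P).
have szg : size g = size f by rewrite size_comp_poly2// size_XaddC.
have q_root : root (map_poly ratr q) (w - 1).
  have w1' : w - 1 != 0 by rewrite subr_eq0.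
  rewrite /root -(mulIr_eq0 _ (mulIf w1')).
  have := congr1 (fun h => (map_poly ratr h).[w - 1]) qX.
  rewrite /= rmorphM rmorphB rmorphXn rmorphD /= map_polyX rmorph1 !hornerE.
  by rewrite subrK wp subrr => ->.
have g_root : root (map_poly ratr g) (w - 1).
  rewrite /root map_comp_poly rmorphD /= map_polyX map_polyC /= rmorph1.
  by rewrite horner_comp !hornerE subrK.
have /dvdpP[c gE] : q %| g.
  rewrite -[_ %| _]negbK -irreducible_poly_coprime//; apply/negP => cop.
  have := coprimep_root (etrans (coprimep_map (@ratr C) _ _) cop) q_root.
  by rewrite (rootP g_root) eqxx.
have q0 : q != 0 by apply: contraTneq irq.1 => ->; rewrite size_poly0.
have szc : (size c <= 1)%N.
  have [->|c0] := eqVneq c 0; first by rewrite size_poly0.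
  move: szf; rewrite -szg gE size_mul// szq addnC -subn1 leq_subLR.
  by rewrite addnC leq_add2r.
have q1 : q.[-1] = 1.
  have := congr1 (fun h => h.[-1]) qX.
  rewrite /= !hornerE addNr expr0n -[(_ == _)]/(p == 0)%N.
  rewrite gtn_eqF ?prime_gt0// add0r.
  by move=> /(congr1 -%R); rewrite mulrN1 !opprK.
have := congr1 (fun h => h.[-1]) gE.
rewrite /g horner_comp !hornerE addNr q1 mulr1 horner_coef0 f0.
rewrite (size1_polyC szc) hornerC => c0.
apply/eqP; rewrite -size_poly_eq0 -szg size_poly_eq0 gE (size1_polyC szc) -c0.
by rewrite polyC0 mul0r.
Qed.

Lemma prime_unity_root_exists (R : realType) p : prime p ->
  exists2 w : R[i], w ^+ p = 1 & w != 1.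
Proof.
move=> pp; have p1 := prime_gt1 pp.
(* [w] is a root of [1 + X + ... + X^(p-1)], whose value at 1 is [p]. *)
have sz : size (\poly_(i < p) (1 : R[i])) = p.
  by rewrite size_poly_eq// oner_neq0.
have [|w wr] := closed_rootP (\poly_(i < p) (1 : R[i])) _.
  by rewrite sz neq_ltn p1 orbT.
have {wr} ws : \sum_(i < p) w ^+ i = 0.
  move/rootP: wr; rewrite horner_poly => ws; rewrite -[RHS]ws.
  by apply: eq_bigr => i _; rewrite mul1r.
exists w.
  by apply/eqP; rewrite -subr_eq0 subrX1 ws mulr0.
apply: contra_eqN ws => /eqP ->.
rewrite (eq_bigr (fun=> 1)) => [|i _]; last by rewrite expr1n.
by rewrite sumr_const card_ord pnatr_eq0 gtn_eqF// prime_gt0.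
Qed.

(** * Additive characters of [Z/p] and eigenvalues of circulant graphs *)

Section Character.
Variables (C : numFieldType) (p : nat) (w : C).
Hypotheses (pp : prime p) (wp : w ^+ p = 1) (w1 : w != 1).

Definition zchar (a : 'F_p) : C := w ^+ a.

Lemma zcharD a b : zchar (a + b) = zchar a * zchar b.
Proof. by rewrite /zchar -exprD /= expr_mod ?Fp_cast. Qed.

Lemma zchar0 : zchar 0 = 1. Proof. by []. Qed.

Lemma zchar1 : zchar 1 = w.
Proof. by rewrite /zchar /= modn_small. Qed.

Lemma zchar_sum0 : \sum_(a : 'F_p) zchar a = 0.
Proof.
have e : w * \sum_a zchar a = \sum_a zchar a.
  rewrite [RHS](reindex_inj (addrI 1)) mulr_sumr.
  by apply: eq_bigr => a _; rewrite zcharD zchar1.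
apply/eqP; move/eqP: e; rewrite -subr_eq0 -{2}[\sum_a _]mul1r -mulrBl mulf_eq0.
by rewrite subr_eq0 (negPf w1).
Qed.

Lemma zchar_sum (k : 'F_p) :
  \sum_(a : 'F_p) zchar (a * k) = if k == 0 then p%:R else 0.
Proof.
case: eqP => [->|/eqP k0].
  rewrite (eq_bigr (fun=> 1)) => [|a _]; last by rewrite mulr0 zchar0.
  by rewrite sumr_const card_Fp.
by rewrite -(reindex_inj (mulIf k0) (P := xpredT) (F := zchar)) zchar_sum0.
Qed.

Lemma zchar_sum_delta (V : lmodType C) (f : 'F_p -> V) (d : 'F_p -> 'F_p) i :
  (forall j, (d j == 0) = (j == i)) ->
  \sum_(j : 'F_p) (\sum_(l : 'F_p) zchar (l * d j)) *: f j = p%:R *: f i.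
Proof.
move=> dE; rewrite (bigD1 i) //= zchar_sum dE eqxx.
rewrite [X in _ + X]big1 ?addr0 // => j ji.
by rewrite zchar_sum dE (negPf ji) scale0r.
Qed.

(** The condition at 0 excludes the multiples of [1 + w + ... + w^(p-1) = 0]. *)
Lemma zchar_lin_indep (c : 'F_p -> rat) :
  c 0 = 0 -> \sum_(a : 'F_p) ratr (c a) * zchar a = 0 -> forall a, c a = 0.
Proof.
move=> c0 cw a; set n := (Zp_trunc (pdiv p)).+2.
have np : n = p by exact: Fp_cast.
pose f := \poly_(i < n) c (inZp i).
have fa (b : 'F_p) : f`_b = c b by rewrite coef_poly ltn_ord valZpK.
suff f0 : f = 0 by rewrite -fa f0 coef0.
apply: (root_unity_lin_indep pp wp w1); first by rewrite -np size_poly.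
  by rewrite (fa 0).
apply/rootP; rewrite -[RHS]cw (@horner_coef_wide _ n).
  by apply: eq_bigr => b _; rewrite coef_map fa.
by rewrite size_map_poly size_poly.
Qed.

Definition cayley_eigenvalue (S : {set 'F_p}) (k : 'F_p) : C :=
  \sum_(x in S) zchar (x * k).

(** Substituting [y = x * m] turns the eigenvalue at [m] into a sum of [zchar] over [m S]; rational
    independence then gives [k S = l S]. *)
Lemma eq_cayley_eigenvalue (S : {set 'F_p}) (k l : 'F_p) :
  0 \notin S -> k != 0 -> l != 0 ->
  cayley_eigenvalue S k = cayley_eigenvalue S l -> l / k \in circulant_group S.
Proof.
move=> S0 k0 l0 e.
have lamE m : m != 0 ->
    cayley_eigenvalue S m = \sum_y ratr (y / m \in S)%:R * zchar y.
  move=> m0; rewrite /cayley_eigenvalue big_mkcond /=.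
  rewrite [RHS](reindex_inj (mulIf m0)); apply: eq_bigr => x _.
  by rewrite mulfK// ratr_nat; case: ifP; rewrite ?mul1r ?mul0r.
have memS y : (y / k \in S) = (y / l \in S).
  (* Difference of the indicator functions of [k S] and [l S]. *)
  pose c y : rat := (y / k \in S)%:R - (y / l \in S)%:R.
  have : c y = 0.
    apply: zchar_lin_indep; first by rewrite /c !mul0r subrr.
    rewrite -[RHS](subrr (cayley_eigenvalue S k)) {2}e !lamE// -sumrB.
    by apply: eq_bigr => z _; rewrite rmorphB mulrBl.
  by rewrite /c; do 2!case: (_ \in S).
have lk0 : l / k != 0 by rewrite mulf_neq0 ?invr_eq0.
rewrite inE unitfE lk0 /=; apply/eqP/setP => y.
apply/imsetP/idP => [[x xS ->]|yS].
  by rewrite mulrAC memS mulrAC mulfV// mul1r.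
exists (y / (l / k)); last by rewrite mulrC divfK.
by rewrite -[_ / _](mulfK l0) -memS invf_div mulrA mulfVK// mulfK.
Qed.

End Character.

(** * Fourier coefficients of the action of a magic unitary *)

Section Fourier.
Variables (C : numFieldType) (p : nat) (w : C).
Hypotheses (pp : prime p) (wp : w ^+ p = 1) (w1 : w != 1).
Variables (B : algType C) (U : 'F_p -> 'F_p -> B).
Hypotheses (Uidem : forall i j, U i j * U i j = U i j)
  (Uorth : forall i j k, j != k -> U i j * U i k = 0)
  (Ucol : forall j, \sum_i U i j = 1).
Local Notation chi := (zchar w).

(* The coordinate at i of alpha(xi^k), and the coefficient of xi^l in
   alpha(xi^k). *)
Definition fourier_row (k i : 'F_p) : B := \sum_(j : 'F_p) chi (j * k) *: U i j.

Definition fourier_coef (k l : 'F_p) : B :=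
  p%:R^-1 *: \sum_(i : 'F_p) chi (- (i * l)) *: fourier_row k i.

Local Notation Y := fourier_row.
Local Notation s := fourier_coef.

Let p_neq0 : p%:R != 0 :> C.
Proof. by rewrite pnatr_eq0 -lt0n prime_gt0. Qed.

(** Multiplicativity of [alpha]: entries of one row are orthogonal, so only diagonal terms
    survive. *)
Lemma fourier_rowD k k' i : Y (k + k') i = Y k i * Y k' i.
Proof.
rewrite /Y mulr_suml; apply: eq_bigr => j _.
rewrite mulr_sumr (bigD1 j)//= big1 ?addr0 => [|j' j'j].
  by rewrite -scalerAl -scalerAr scalerA Uidem mulrDr zcharD.
by rewrite -scalerAl -scalerAr Uorth 1?eq_sym// !scaler0.
Qed.

Lemma fourier_row_inv i j :
  U i j = p%:R^-1 *: \sum_(k : 'F_p) chi (- (j * k)) *: Y k i.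
Proof.
transitivity (p%:R^-1 *: \sum_(j' : 'F_p)
    (\sum_(k : 'F_p) chi (k * (j' - j))) *: U i j').
  rewrite (zchar_sum_delta pp wp w1 _ (i := j)).
    by rewrite scalerA mulVf ?scale1r.
  by move=> j'; rewrite subr_eq0.
congr (_ *: _); under [RHS]eq_bigr => k _ do rewrite scaler_sumr.
rewrite exchange_big; apply: eq_bigr => j' _; rewrite scaler_suml.
apply: eq_bigr => k _; rewrite scalerA -zcharD//; congr (chi _ *: _); ring.
Qed.

Lemma fourier_coef_inv k i : Y k i = \sum_(l : 'F_p) chi (i * l) *: s k l.
Proof.
transitivity (p%:R^-1 *: \sum_(i' : 'F_p)
    (\sum_(l : 'F_p) chi (l * (i - i'))) *: Y k i').
  rewrite (zchar_sum_delta pp wp w1 _ (i := i)).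
    by rewrite scalerA mulVf ?scale1r.
  by move=> i'; rewrite subr_eq0 eq_sym.
rewrite /s; under [RHS]eq_bigr => l _ do rewrite scalerA mulrC -scalerA.
rewrite -scaler_sumr; congr (_ *: _).
under [RHS]eq_bigr => l _ do rewrite scaler_sumr.
rewrite exchange_big; apply: eq_bigr => i' _; rewrite scaler_suml.
apply: eq_bigr => l _; rewrite scalerA -zcharD//; congr (chi _ *: _); ring.
Qed.

Lemma fourier_coefD k k' l : s (k + k') l = \sum_a s k a * s k' (l - a).
Proof.
rewrite {1}/s.
transitivity (p%:R^-1 *: \sum_(a : 'F_p) \sum_(b : 'F_p)
    (\sum_(i : 'F_p) chi (i * (a + b - l))) *: (s k a * s k' b)).
  congr (_ *: _).
  transitivity (\sum_(i : 'F_p) \sum_(a : 'F_p) \sum_(b : 'F_p)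
      chi (i * (a + b - l)) *: (s k a * s k' b)).
    apply: eq_bigr => i _; rewrite fourier_rowD !fourier_coef_inv mulr_suml.
    rewrite scaler_sumr; apply: eq_bigr => a _.
    rewrite mulr_sumr scaler_sumr; apply: eq_bigr => b _.
    rewrite -scalerAl -scalerAr !scalerA -!zcharD//; congr (chi _ *: _); ring.
  rewrite exchange_big; apply: eq_bigr => a _.
  by rewrite exchange_big; apply: eq_bigr => b _; rewrite scaler_suml.
rewrite scaler_sumr; apply: eq_bigr => a _.
rewrite (zchar_sum_delta pp wp w1 _ (i := l - a)).
  by rewrite scalerA mulVf ?scale1r.
by move=> b; rewrite -[b == _]subr_eq0 opprB; congr (_ == 0); ring.
Qed.

Lemma fourier_coef0 k : k != 0 -> s k 0 = 0.
Proof.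
move=> k0; rewrite /s (eq_bigr (Y k)) => [|i _]; last first.
  by rewrite mulr0 oppr0 zchar0 scale1r.
rewrite exchange_big; under eq_bigr => j _ do rewrite -scaler_sumr Ucol.
by rewrite -scaler_suml zchar_sum// (negPf k0) scale0r scaler0.
Qed.

(** The hypothesis is [du = ud] for a circulant [d]. It makes [alpha(xi^k)] an eigenvector for the
    eigenvalue at [k], so a nonzero coefficient forces the eigenvalues at [k] and [l] to agree. *)
Lemma fourier_coef_eigen (S : {set 'F_p}) k l :
  (forall i j, \sum_(x in S) U (i + x) j = \sum_(x in S) U i (j - x)) ->
  cayley_eigenvalue w S l *: s k l = cayley_eigenvalue w S k *: s k l.
Proof.
move=> US.
have YS i : \sum_(x in S) Y k (i + x) = cayley_eigenvalue w S k *: Y k i.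
  rewrite exchange_big /=.
  under eq_bigr => j _ do rewrite -scaler_sumr US scaler_sumr.
  rewrite exchange_big scaler_suml; apply: eq_bigr => x _.
  rewrite (reindex_inj (addIr x)) scaler_sumr; apply: eq_bigr => j _ /=.
  by rewrite addrK scalerA -zcharD// mulrDl addrC.
rewrite /s scalerA mulrC -scalerA [RHS]scalerA mulrC -[RHS]scalerA.
congr (_ *: _); rewrite [RHS]scaler_sumr.
under [RHS]eq_bigr => i _ do rewrite scalerA mulrC -scalerA -YS scaler_sumr.
rewrite exchange_big scaler_suml; apply: eq_bigr => x _.
rewrite [RHS](reindex_inj (addIr (- x))) scaler_sumr; apply: eq_bigr => i _ /=.
rewrite addrNK scalerA -zcharD//; congr (chi _ *: _); ring.
Qed.

(** Each [Y k i] is a power of [Y 1 i], and Fourier inversion recovers [U] from them. *)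
Lemma magic_comm :
  (forall a b, s 1 a * s 1 b = s 1 b * s 1 a) ->
  forall i j i' j', U i j * U i' j' = U i' j' * U i j.
Proof.
move=> sC.
have Y1C i i' : GRing.comm (Y 1 i) (Y 1 i').
  rewrite /GRing.comm !fourier_coef_inv mulr_suml mulr_sumr.
  apply: eq_bigr => a _; rewrite mulr_suml mulr_sumr; apply: eq_bigr => b _.
  move: (s 1 a) (s 1 b) (sC a b) => x y xy.
  by rewrite -!scalerAl -!scalerAr xy scalerA mulrC -scalerA.
have YX n i : (0 < n)%N -> Y n%:R i = Y 1 i ^+ n.
  elim: n => // -[_ _|n IHn _]; first by rewrite expr1.
  by rewrite mulrSr fourier_rowD IHn// [in RHS]exprSr.
(* [YX] covers positive exponents only, so [k = 0] is written as [p]. *)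
have YE k : exists n, forall i, Y k i = Y 1 i ^+ n.
  have [k0|kgt0] := posnP k; [exists p|exists k] => i.
    rewrite -YX ?prime_gt0//; congr (Y _ i); apply: val_inj.
    by rewrite /= val_Fp_nat// modnn.
  by rewrite -YX// natr_Zp.
have YC k k' i i' : GRing.comm (Y k i) (Y k' i').
  have [[n ->] [n' ->]] := (YE k, YE k').
  by apply: commrX; apply/commr_sym/commrX/commr_sym.
move=> i j i' j'; rewrite !fourier_row_inv -!scalerAl -!scalerAr.
congr (_ *: (_ *: _)); apply: commr_sum => k' _.
apply/commr_sym/commr_sum => k _.
move: (Y k i) (Y k' i') (YC k k' i i') => x y xy.
by rewrite /GRing.comm -!scalerAl -!scalerAr xy scalerA mulrC -scalerA.
Qed.

End Fourier.

(** Lets [ring] derive one linear equation from another by comparing differences. *)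
Lemma eq_subr_transfer (V : zmodType) (a b c d : V) :
  c = d -> a - b = c - d -> a = b.
Proof. by move=> -> /eqP; rewrite subrr subr_eq0 => /eqP. Qed.

(** * Consequences of 2-maximality for the coefficients *)

Section TwoMaximal.
Variables (K : finFieldType) (E : {set K}).
Hypotheses (E2 : two_maximal (mem E)) (K3 : 3%:R != 0 :> K).

Let K2 : 2%:R != 0 :> K.
Proof. by case: E2; rewrite unitfE. Qed.

Let E_neq0 a : a \in E -> a != 0.
Proof. by case: E2 => _ [Eu _ _] _ /Eu; rewrite unitfE. Qed.

Let E1 : 1 \in E.
Proof. by case: E2 => _ [_ [? _] _]. Qed.

Let E_div a b : a \in E -> b \in E -> a / b \in E.
Proof. by case: E2 => _ [_ [_ H] _] _; apply: H. Qed.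

Let E_mul a b : a \in E -> b \in E -> a * b \in E.
Proof.
by move=> aE bE; rewrite -[b]invrK -[b^-1]mul1r E_div// E_div.
Qed.

Let E_opp a : a \in E -> - a \in E.
Proof. by case: E2 => _ [_ _ m1] _ aE; rewrite -mulN1r E_mul. Qed.

Let addrr_neq0 (a : K) : a != 0 -> a + a != 0.
Proof. by move=> a0; rewrite -mulr2n -mulr_natl mulf_neq0. Qed.

(** [a - 2c] is the exponent of [xi^a xi^(-2c)]; this bounds how many such products share an
    exponent. *)
Lemma two_maximal_collision a b c d :
  a \in E -> b \in E -> c \in E -> d \in E ->
  a - 2%:R * c = b - 2%:R * d -> a = b \/ a = - b.
Proof.
case: E2 => _ _ H aE bE cE dE e; apply: (H a b c d) => //.
by apply: (eq_subr_transfer e); ring.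
Qed.

(** The equation is the collision [a - 2c = b - 2b]; its case [a = -b] would force [c = 0]. *)
Lemma two_maximal_midpoint a b c :
  a \in E -> b \in E -> c \in E -> a + b = 2%:R * c -> a = c /\ b = c.
Proof.
move=> aE bE cE e.
have [|ab|ab] := @two_maximal_collision a b c b aE bE cE bE.
- by rewrite -e; ring.
- suff ac : a = c by rewrite -ab.
  by apply: (mulfI K2); rewrite -e -ab; ring.
- have /eqP := e; rewrite ab addNr eq_sym mulf_eq0 (negPf K2) /= => c0.
  by rewrite (negPf (E_neq0 cE)) in c0.
Qed.

(** With 2 in [E], the collision [4 - 2 * 2 = 2 - 2 * 1] would give [4 = 2] or [4 = -2], that is
    [2 = 0] or [6 = 0]. *)
Lemma two_maximal_nat2 : 2%:R \notin E.
Proof.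
apply/negP => t.
have [||] := two_maximal_collision (E_mul t t) t t E1.
- ring.
- move=> e; have /eqP : 2%:R * 2%:R - 2%:R = 0 :> K by rewrite e subrr.
  by rewrite (_ : _ - _ = 2%:R) ?(negPf K2)//; ring.
- move=> e; have /eqP : 2%:R * 2%:R + 2%:R = 0 :> K by rewrite e addNr.
  rewrite (_ : _ + _ = 2%:R * 3%:R); last ring.
  by rewrite mulf_eq0 (negPf K2) (negPf K3).
Qed.

Variables (B : pzRingType) (s : K -> K -> B).
Hypotheses
  (sD : forall k k' l, s (k + k') l = \sum_a s k a * s k' (l - a))
  (s0 : forall k l, k != 0 -> l / k \notin E -> s k l = 0).

(* The coefficient of xi^(k a) in alpha(xi^k). *)
Let P k a := s k (k * a).

(** [e_uniq] leaves only the term [x = k * e] of the convolution: every other one has a factor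
    outside the support. *)
Lemma two_maximal_conv k k' k'' e : k'' = k + k' -> k != 0 -> k' != 0 ->
  (forall a b, a \in E -> b \in E -> k'' * e = k * a + k' * b -> a = e) ->
  P k'' e = P k e * P k' e.
Proof.
move=> -> k0 k'0 e_uniq; rewrite /P mulrDl sD (bigD1 (k * e))//= addrAC subrr.
rewrite add0r big1 ?addr0// => x xe.
have [xE|xE] := boolP (x / k \in E); last by rewrite s0// mul0r.
set y := _ - x.
have [yE|yE] := boolP (y / k' \in E); last by rewrite (s0 _ yE)// mulr0.
case/eqP: xe; rewrite -(e_uniq _ _ xE yE) ![_ * (_ / _)]mulrC !divfK//.
by rewrite [x + _]addrC addrNK mulrDl.
Qed.

Let S a := P 1 a.
Let T a := P (- 1) a.

Let N1 : - 1 != 0 :> K. Proof. by rewrite oppr_eq0 oner_neq0. Qed.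
Let N2 : - 2%:R != 0 :> K. Proof. by rewrite oppr_eq0. Qed.

Let T2 e : e \in E -> P (- 2%:R) e = T e * T e.
Proof.
move=> eE; apply: (@two_maximal_conv (- 1) (- 1)) => //; first ring.
move=> a b aE bE h; apply: proj1 (two_maximal_midpoint aE bE eE _).
by apply: (eq_subr_transfer h); ring.
Qed.

Let S2 e : e \in E -> P 2%:R e = S e * S e.
Proof.
move=> eE; apply: (@two_maximal_conv 1 1); rewrite ?oner_neq0//.
move=> a b aE bE h; apply: proj1 (two_maximal_midpoint aE bE eE _).
by apply: (eq_subr_transfer (esym h)); ring.
Qed.

(** The next four identities split -1 as [1 - 2] and 1 as [2 - 1], in both orders; each exponent
    equation is a midpoint equation. With [TSE] they make [T e] a generalized inverse of [S e]. *)
Let STT e : e \in E -> T e = S e * (T e * T e).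
Proof.
move=> eE; rewrite -T2//; apply: (@two_maximal_conv 1 (- 2%:R)) => //.
- ring.
- exact: oner_neq0.
move=> a b aE bE h; have [|-> -> //] := two_maximal_midpoint aE eE bE.
by apply: (eq_subr_transfer (esym h)); ring.
Qed.

Let TTS e : e \in E -> T e = T e * T e * S e.
Proof.
move=> eE; rewrite -T2//; apply: (@two_maximal_conv (- 2%:R) 1) => //.
- ring.
- exact: oner_neq0.
move=> a b aE bE h; have [|-> //] := two_maximal_midpoint eE bE aE.
by apply: (eq_subr_transfer (esym h)); ring.
Qed.

Let SST e : e \in E -> S e = S e * S e * T e.
Proof.
move=> eE; rewrite -S2//.
apply: (@two_maximal_conv 2%:R (- 1)) => //; first ring.
move=> a b aE bE h; have [|-> //] := two_maximal_midpoint eE bE aE.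
by apply: (eq_subr_transfer h); ring.
Qed.

Let TSS e : e \in E -> S e = T e * (S e * S e).
Proof.
move=> eE; rewrite -S2//.
apply: (@two_maximal_conv (- 1) 2%:R) => //; first ring.
move=> a b aE bE h; have [|-> -> //] := two_maximal_midpoint aE eE bE.
by apply: (eq_subr_transfer h); ring.
Qed.

Let TSE e : e \in E -> T e * S e = S e * T e.
Proof.
move=> eE; transitivity (T e * (S e * S e * T e)); first by rewrite -SST.
by rewrite !mulrA -[T e * S e * S e]mulrA -TSS.
Qed.

(* The exponent a - 2c is not in -E and is reached only by the pairs (a, c) and
   (-a, c - a); the second product vanishes unless c - a lies in E. *)
Let collision_sum a c : a \in E -> c \in E -> a != c ->
  S a * P (- 2%:R) c + S (- a) * s (- 2%:R) (2%:R * (a - c)) = 0.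
Proof.
move=> aE cE ac; pose l := a - 2%:R * c.
have <- : s (1 - 2%:R) l = 0.
  rewrite (_ : 1 - 2%:R = - 1); last ring.
  apply: s0 => //; rewrite invrN1 mulrN1.
  (* If [- l] were in [E], then [c] would be the midpoint of [a] and [- l], hence equal to [a]. *)
  apply/negP => lE; case/eqP: ac.
  apply: proj1 (two_maximal_midpoint aE lE cE _).
  by rewrite /l; ring.
rewrite sD (bigD1 a)//= (bigD1 (- a))/=; last first.
  by rewrite -subr_eq0 -opprD oppr_eq0 addrr_neq0// E_neq0.
rewrite big1 ?addr0 => [|x /andP[xa xNa]].
  rewrite /S /P !mul1r; congr (_ * s _ _ + _ * s _ _); rewrite /l; ring.
have [xE|xE] := boolP (x \in E); last by rewrite s0 ?oner_neq0 ?mul0r// divr1.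
have [dE|dE] := boolP ((l - x) / - 2%:R \in E); last first.
  by rewrite (s0 _ dE)// mulr0.
have [|e|e] := @two_maximal_collision x a _ c xE aE dE cE.
- by rewrite invrN !mulrN opprK mulrC divfK// /l; ring.
- by rewrite e eqxx in xa.
- by rewrite e eqxx in xNa.
Qed.

(** The rules [T c = T c T c S c] and [S c = T c S c S c] undo the squaring. *)
Let S_mulTT a c : a \in E -> c \in E -> S a * (T c * T c) = 0 ->
  S a * T c = 0 /\ S a * S c = 0.
Proof.
move=> aE cE z; have z' : S a * T c = 0.
  by rewrite (TTS cE) mulrA z mul0r.
by split=> //; rewrite (TSS cE) mulrA z' mul0r.
Qed.

(* For c = -a the second pair would need -2a in E, that is 2 in E. *)
Let S_mul_opp a : a \in E -> S a * (T (- a) * T (- a)) = 0.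
Proof.
move=> aE; have NaE := E_opp aE.
rewrite -T2// -[RHS](@collision_sum a (- a))//; last first.
  by rewrite -subr_eq0 opprK addrr_neq0// E_neq0.
rewrite [s _ (_ * (_ - _))]s0 ?mulr0 ?addr0// opprK.
apply: contra two_maximal_nat2 => h; have /E_opp := E_div h aE.
suff -> : - (2%:R * (a + a) / - 2%:R / a) = 2%:R by [].
by field; rewrite N2 E_neq0.
Qed.

(** From [S a S (- a) = 0] follows [T a S (- a) = 0], so multiplying [collision_sum] by [T a] on the
    left removes its second product. Then [S a = S a S a T a] and [TSE] yield [S a T c T c = 0]. *)
Let S_mul0 a c : a \in E -> c \in E -> a != c -> S a * S c = 0.
Proof.
move=> aE cE ac; have NaE := E_opp aE.
have [_ SS0] := S_mulTT aE NaE (S_mul_opp aE).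
have TS0 : T a * S (- a) = 0 by rewrite (TTS aE) -mulrA SS0 mulr0.
apply: proj2 (S_mulTT aE cE _); rewrite (SST aE) -T2//.
have := congr1 ( *%R (T a)) (collision_sum aE cE ac).
rewrite mulr0 mulrDr [T a * (S (- a) * _)]mulrA TS0 mul0r addr0 => h.
by rewrite -(mulrA (S a)) -TSE// -!mulrA h mulr0.
Qed.

Lemma two_maximal_comm a b : s 1 a * s 1 b = s 1 b * s 1 a.
Proof.
have SE x : s 1 x = S x by rewrite /S /P mul1r.
have z x : x \notin E -> s 1 x = 0 by move=> xE; rewrite s0 ?oner_neq0// divr1.
have [aE|/z ->] := boolP (a \in E); last by rewrite mul0r mulr0.
have [bE|/z ->] := boolP (b \in E); last by rewrite mul0r mulr0.
have [->//|ab] := eqVneq a b.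
by rewrite !SE !S_mul0// eq_sym.
Qed.

End TwoMaximal.

(** * Commutation of the entries for a circulant graph *)

Lemma graph_magic_unitary_entry (R : realType) (n : nat) (X : sgraph n)
    (B : cstarType R) (u : 'M[B]_n) i k : graph_magic_unitary X u ->
  \sum_j (edge X i j)%:R * u j k = \sum_j u i j * (edge X j k)%:R.
Proof.
move=> [_ /matrixP/(_ i k)]; rewrite !mxE => e.
transitivity (\sum_j adjmx B X i j * u j k).
  by apply: eq_bigr => j _; rewrite mxE.
by rewrite e; apply: eq_bigr => j _; rewrite mxE.
Qed.

Lemma circulant_magic_comm (R : realType) (p : nat) (X : sgraph p)
    (l : 'F_p -> 'I_p) (S : {set 'F_p}) (B : cstarType R) (u : 'M[B]_p) :
  prime p -> (5 <= p)%N -> circulant X l S ->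
  two_maximal (mem (circulant_group S)) -> graph_magic_unitary X u ->
  forall i j i' j', u i j * u i' j' = u i' j' * u i j.
Proof.
move=> pp p5 [lbij lS] E2 uX i j i' j'; have [[uproj uorth _ _ ucol] _] := uX.
have [w wp w1] := prime_unity_root_exists R pp.
have [l' lK l'K] := lbij.
pose U (i j : 'F_p) := u (l i) (l j).
rewrite -(l'K i) -(l'K j) -(l'K i') -(l'K j').
have Uorth (a b c : 'F_p) : b != c -> U a b * U a c = 0.
  by move=> bc; apply: uorth; rewrite (inj_eq (can_inj lK)).
have Uidem a b : U a b * U a b = U a b by case: (uproj (l a) (l b)).
have Ucol b : \sum_(a : 'F_p) U a b = 1.
  by rewrite -(ucol (l b)) [RHS](reindex l)//; exact: onW_bij.
apply: (magic_comm pp wp w1 Uidem Uorth).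
have S0 : 0 \notin S by rewrite -(subrr (0 : 'F_p)) -lS edge_irr.
(* [du = ud] entrywise: the neighbours of [l a] are the [l (a + x)], those of [l b] the [l (b - x)],
   with [x] in [S]. *)
have US (a b : 'F_p) : \sum_(x in S) U (a + x) b = \sum_(x in S) U a (b - x).
  have reX (G : 'I_p -> B) (g : 'F_p -> 'F_p) :
      injective g -> \sum_j G j = \sum_(x : 'F_p) G (l (g x)).
    move=> gI; rewrite (reindex l); last exact: onW_bij.
    by rewrite (reindex_inj gI).
  transitivity (\sum_j (edge X (l a) j)%:R * u j (l b)).
    rewrite (reX _ (fun x => a + x)); last exact: addrI.
    rewrite big_mkcond; apply: eq_bigr => x _; rewrite lS addrAC subrr add0r.
    by case: (x \in S); rewrite ?mul1r ?mul0r.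
  transitivity (\sum_j u (l a) j * (edge X j (l b))%:R).
    exact: graph_magic_unitary_entry.
  rewrite (reX _ (fun x => b - x)); last exact: can_inj (subKr b).
  rewrite [RHS]big_mkcond; apply: eq_bigr => x _; rewrite lS subKr.
  by case: (x \in S); rewrite ?mulr1 ?mulr0.
apply: (two_maximal_comm E2).
- rewrite -(dvdn_pcharf (pchar_Fp pp)); apply/negP => /(@dvdn_leq p 3 isT).
  by apply/negP; rewrite -ltnNge (leq_trans _ p5).
- by move=> k k' m; apply: fourier_coefD.
(* For [m <> 0], equal eigenvalues would put [m / k] in the group; [m = 0] is settled by the column
   sums. *)
move=> k m k0 mk; have [->|m0] := eqVneq m 0; first exact: fourier_coef0.
have /eqP := fourier_coef_eigen pp wp k m US.
rewrite -subr_eq0 -scalerBl scaler_eq0 subr_eq0.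
case/orP => [/eqP e|/eqP//]; case/negP: mk.
exact: (eq_cayley_eigenvalue pp wp w1 S0 k0 m0 (esym e)).
Qed.

(** * Commuting entries and projections indexed by automorphisms *)

Section CommutingMagicUnitary.
Variables (R : realType) (n : nat) (X : sgraph n) (B : cstarType R).
Variable u : 'M[B]_n.
Hypotheses (uM : graph_magic_unitary X u)
  (uC : forall i j i' j', u i j * u i' j' = u i' j' * u i j).

(** Defined for every map [f], since expanding the product of all column sums produces all of
    them. *)
Definition map_proj (f : 'I_n -> 'I_n) : B := \prod_j u (f j) j.
Local Notation Q := map_proj.

(** By commutation the factor [u (f j) j] comes to the front; it equals [u i j] or is orthogonal to
    it in column [j]. *)
Lemma entry_map_proj f i j : u i j * Q f = (i == f j)%:R * Q f.
Proof.
have [[up _ uo _ _] _] := uM.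
have absorb k (r : seq 'I_n) : k \in r ->
    u (f k) k * \prod_(j <- r) u (f j) j = \prod_(j <- r) u (f j) j.
  elim: r => // a r IHr; rewrite inE big_cons; case: eqP => [<- _|_ /= /IHr kr].
    by rewrite mulrA; case: (up (f k) k) => ->.
  by rewrite mulrA uC -mulrA kr.
have Qj : u (f j) j * Q f = Q f by apply: absorb; rewrite mem_index_enum.
case: eqP => [->|/eqP ij]; first by rewrite mul1r.
by rewrite -Qj mulrA uo// mul0r mul0r.
Qed.

Lemma map_projM f g : Q f * Q g = [forall j, f j == g j]%:R * Q g.
Proof.
have big (r : seq 'I_n) :
    (\prod_(j <- r) u (f j) j) * Q g = (all (fun j => f j == g j) r)%:R * Q g.
  elim: r => [|a r IHr]; first by rewrite big_nil.
  rewrite big_cons -mulrA IHr /=.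
  case: (all _ r); last by rewrite andbF mul0r mulr0.
  by rewrite andbT mul1r entry_map_proj.
rewrite big; congr (_%:R * _); congr nat_of_bool.
apply/allP/forallP => [h j|h j _]; last exact: h.
by apply: h; rewrite mem_index_enum.
Qed.

(** [Q f] absorbs the factors of its adjoint, so it equals the self-adjoint product of its adjoint
    with itself. *)
Lemma map_proj_star f : star (Q f) = Q f.
Proof.
have [[up _ _ _ _] _] := uM.
have sE (r : seq 'I_n) : star (\prod_(j <- r) u (f j) j) * Q f = Q f.
  elim: r => [|a r IHr].
    have s1 : star (1 : B) = 1.
      by have := starM 1 (star (1 : B)); rewrite mul1r starK mul1r => <-.
    by rewrite big_nil s1 mul1r.
  rewrite big_cons starM; case: (up (f a) a) => _ ->.
  by rewrite -mulrA entry_map_proj eqxx mul1r.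
by rewrite -{1}(sE (index_enum _)) starM starK sE.
Qed.

Lemma map_proj_inj f j k : j != k -> f j = f k -> Q f = 0.
Proof.
have [[_ uo _ _ _] _] := uM.
move=> jk fjk; have := entry_map_proj f (f j) j; rewrite eqxx mul1r => <-.
have := entry_map_proj f (f k) k; rewrite eqxx mul1r => <-.
by rewrite mulrA fjk uo ?mul0r// eq_sym.
Qed.

(** Multiply the entry [(f j, k)] of [du = ud] by [Q f]: the left sum keeps the index [f k], and the
    right one, by injectivity of [f], the index [j]. *)
Lemma map_proj_edge f j k : edge X (f j) (f k) != edge X j k -> Q f = 0.
Proof.
have [fI|fNI] := boolP (injectiveb f); last first.
  by case/injectivePn: fNI => a [b ab fab] _; exact: map_proj_inj fab.
have fi := injectiveP _ fI.
have := graph_magic_unitary_entry (f j) k uM.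
move=> /(congr1 ( *%R^~ (Q f))); rewrite !mulr_suml.
rewrite (bigD1 (f k))//= big1 ?addr0 => [|i ik]; last first.
  by rewrite -mulrA entry_map_proj (negPf ik) mul0r mulr0.
rewrite [RHS](bigD1 j)//= big1 ?addr0 => [|i ij]; last first.
  rewrite [_ * _%:R]commr_nat -mulrA entry_map_proj (inj_eq fi) eq_sym (negPf ij).
  by rewrite mul0r mulr0.
rewrite [_ * _%:R]commr_nat -!mulrA !entry_map_proj !eqxx mul1r.
by case: (edge X _ _); case: (edge X _ _) => //; rewrite !mul1r !mul0r.
Qed.

(** The product of the column sums expands into all [Q f], of which only automorphisms survive. *)
Lemma sum_map_proj : \sum_(g : [subg graph_aut X]) Q (val g) = 1.
Proof.
have [[_ _ _ _ uc] _] := uM.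
pose h (g : [subg graph_aut X]) := [ffun x => val g x].
have hI : injective h.
  move=> g g' /ffunP e; apply/val_inj/permP => x.
  by have := e x; rewrite !ffunE.
transitivity (\sum_(f : {ffun 'I_n -> 'I_n}) Q f); last first.
  rewrite -(bigA_distr_bigA (fun j i => u i j)) big1// => j _; exact: uc.
rewrite [RHS](bigID (fun f => f \in h @: setT)) /= [X in _ + X]big1 ?addr0.
  rewrite big_imset /=; last by move=> g g' _ _; exact: hI.
  apply: eq_big => [g|g _]; first by rewrite inE.
  by apply: eq_bigr => j _; rewrite ffunE.
move=> f fNh; have [fI|fNI] := boolP (injectiveb f); last first.
  by case/injectivePn: fNI => a [b ab fab]; exact: map_proj_inj fab.
pose g := perm (injectiveP _ fI).
have gE x : g x = f x by rewrite permE.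
have [gX|/forallPn[j /forallPn[k jk]]] :=
  boolP [forall i, forall j, edge X (g i) (g j) == edge X i j]; last first.
  by apply: (@map_proj_edge f j k); rewrite -!gE.
have gG : g \in graph_aut X by rewrite inE.
case/imsetP: fNh; exists (subg (graph_aut_group X) g) => //.
by apply/ffunP => x; rewrite ffunE /= subgK// gE.
Qed.

Definition aut_hom (f : funalg R [subg graph_aut X]) : B :=
  \sum_g f g *: Q (val g).

Lemma aut_hom_entry i j : aut_hom (aut_magic_unitary R X i j) = u i j.
Proof.
rewrite -[RHS]mulr1 -sum_map_proj mulr_sumr; apply: eq_bigr => g _.
rewrite entry_map_proj mxE ffunE eq_sym; case: (_ == _).
  by rewrite scale1r mul1r.
by rewrite scale0r mul0r.
Qed.

Lemma aut_hom_starhom : starhom aut_hom.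
Proof.
split.
- move=> a x y; rewrite /aut_hom scaler_sumr -big_split.
  by apply: eq_bigr => g _; rewrite !ffunE scalerDl scalerA.
- by rewrite -sum_map_proj; apply: eq_bigr => g _; rewrite ffunE scale1r.
- move=> x y; rewrite /aut_hom mulr_suml; apply: eq_bigr => g _.
  rewrite mulr_sumr (bigD1 g)//= big1 ?addr0 => [|g' g'g].
    rewrite -scalerAl -scalerAr scalerA ffunE map_projM.
    have -> : [forall j, val g j == val g j] by apply/forallP.
    by rewrite mul1r.
  rewrite -scalerAl -scalerAr map_projM.
  have /negPf -> : ~~ [forall j, val g j == val g' j].
    apply: contra g'g => /forallP e; apply/eqP/val_inj/permP => j.
    by rewrite (eqP (e j)).
  by rewrite mul0r !scaler0.
move=> x; have star0 : star (0 : B) = 0.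
  by rewrite -[X in star X](scale0r (0 : B)) starZ rmorph0 scale0r.
rewrite /aut_hom (big_morph _ (@starD _ B) star0); apply: eq_bigr => g _.
by rewrite starZ map_proj_star ffunE.
Qed.

Lemma starhom_aut_homE (phi : funalg R [subg graph_aut X] -> B) :
  starhom phi -> (forall i j, phi (aut_magic_unitary R X i j) = u i j) ->
  phi = aut_hom.
Proof.
move=> [phiL phi1 phiM _] phiu.
have phi0 : phi 0 = 0.
  have := phiL 1 0 0; rewrite !scale1r addr0 => e.
  by apply: (addrI (phi 0)); rewrite addr0 -e.
have phiD : {morph phi : x y / x + y}.
  by move=> x y; rewrite -{1}[x]scale1r phiL scale1r.
have phiZ a x : phi (a *: x) = a *: phi x.
  by rewrite -[a *: x]addr0 phiL phi0 addr0.
apply/funext => f.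
(* The indicator function of [h], written as a product of entries so that its image under [phi] is
   determined. *)
pose delta (h : [subg graph_aut X]) : funalg R [subg graph_aut X] :=
  \prod_j aut_magic_unitary R X (val h j) j.
have deltaE h g : delta h g = (g == h)%:R.
  have prodE (r : seq 'I_n) :
      (\prod_(j <- r) aut_magic_unitary R X (val h j) j :
         funalg R [subg graph_aut X]) g
      = (all (fun j => val g j == val h j) r)%:R.
    elim: r => [|a r IHr]; first by rewrite big_nil ffunE.
    rewrite big_cons ffunE IHr mxE ffunE /=.
    by case: (_ == _); rewrite ?mul1r ?mul0r.
  rewrite prodE; congr (nat_of_bool _)%:R; apply/allP/eqP => [e|-> //].
  by apply/val_inj/permP => j; apply/eqP/e; rewrite mem_index_enum.
have {1}-> : f = \sum_h f h *: delta h.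
  apply/ffunP => g; rewrite (@sum_ffunE _ R[i]) (bigD1 g)//= big1 ?addr0.
    by rewrite ffunE deltaE eqxx [RHS]mulr1.
  by move=> h hg; rewrite ffunE deltaE eq_sym (negPf hg) [LHS]mulr0.
rewrite (big_morph phi phiD phi0); apply: eq_bigr => h _; rewrite phiZ.
congr (_ *: _); rewrite (big_morph phi phiM phi1).
by apply: eq_bigr => j _; rewrite phiu.
Qed.

End CommutingMagicUnitary.

(** * Universality of [C(Aut X)] and conclusion *)

Lemma aut_universal (R : realType) (n : nat) (X : sgraph n) :
  (forall (B : cstarType R) (u : 'M[B]_n), graph_magic_unitary X u ->
    forall i j i' j', u i j * u i' j' = u i' j' * u i j) ->
  universal_graph_algebra X (aut_magic_unitary R X).
Proof.
move=> comm; split=> [|B u uX]; first exact: aut_magic_unitaryP.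
have uC := comm B u uX; exists (aut_hom u).
split; first by split; [exact: aut_hom_starhom|exact: aut_hom_entry].
by move=> phi [phiH phiu]; apply/esym/starhom_aut_homE.
Qed.

Lemma starhom_comp (R : realType) (A B D : cstarType R)
    (g : B -> D) (f : A -> B) : starhom g -> starhom f -> starhom (g \o f).
Proof.
move=> [gL g1 gM gS] [fL f1 fM fS]; split=> [a x y||x y|x] /=.
- by rewrite fL gL.
- by rewrite f1 g1.
- by rewrite fM gM.
- by rewrite fS gS.
Qed.

(** The two universal maps are mutually inverse, since a universal algebra has only the identity as
    endomorphism fixing the generators. *)
Lemma universal_graph_algebra_unique (R : realType) (n : nat) (X : sgraph n)
    (A B : cstarType R) (u : 'M[A]_n) (v : 'M[B]_n) :
  universal_graph_algebra X u -> universal_graph_algebra X v ->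
  exists f : A -> B,
    [/\ starhom f, forall i j, f (u i j) = v i j & bijective f].
Proof.
have endo (D : cstarType R) (w : 'M[D]_n) (h : D -> D) :
    universal_graph_algebra X w -> starhom h ->
    (forall i j, h (w i j) = w i j) -> h =1 id.
  move=> [wX wU] hH hw x; have [k [_ kU]] := wU D w wX.
  by rewrite -(kU h)// (kU id).
move=> uU vU; have [[uX uE] [vX vE]] := (uU, vU).
have [f [[fH fu] _]] := uE B v vX; have [g [[gH gv] _]] := vE A u uX.
exists f; split=> //; exists g => x.
  apply: (endo A u (g \o f)) => //; first exact: starhom_comp.
  by move=> i j; rewrite /= fu gv.
apply: (endo B v (f \o g)) => //; first exact: starhom_comp.
by move=> i j; rewrite /= gv fu.
Qed.

Theorem theorem4p1 (R : realType) (p : nat) (X : sgraph p)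
    (l : 'F_p -> 'I_p) (S : {set 'F_p}) :
  prime p -> (5 <= p)%N -> circulant X l S ->
  two_maximal (mem (circulant_group S)) ->
  no_quantum_symmetry R X.
Proof.
move=> pp p5 XlS E2.
have univ : universal_graph_algebra X (aut_magic_unitary R X).
  apply: aut_universal => B u uX.
  exact: circulant_magic_comm pp p5 XlS E2 uX.
split; first by exists (funalg R [subg graph_aut X]), (aut_magic_unitary R X).
by move=> A u uU; exact: universal_graph_algebra_unique uU univ.
Qed.
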